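(* Let $K$ be an algebraically closed field. Let $X = \{F = 0\} \subset \mathbb{P}^3_K$ be a quartic surface such that $\mathrm{Sing}(X)$ is a finite set. If $X$ has a triple point, then $|\mathrm{Sing}(X)| \leq 7$. More generally, let $X = \{F = 0\} \subset \mathbb{P}^3_K$ be a surface of degree $d$ such that $\mathrm{Sing}(X)$ is a finite set and $X$ has a point of multiplicity $d-1$. Then $$|\mathrm{Sing}(X)| \leq 1 + \frac{d(d-1)}{2}.$$
   Context: $\mathrm{Sing}(X)$ is the set of singular points of $X$, i.e. the points where $F$ and all its partial derivatives vanish. A triple point is a point of multiplicity $3$. *)

(* Defs.v *)
From HB Require Import structures.
From mathcomp Require Import all_boot all_order all_algebra.
From mathcomp Require Import mpoly.
From mathcomp Require Import classical_sets cardinality.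

Set Implicit Arguments.
Unset Strict Implicit.
Unset Printing Implicit Defensive.

Import GRing.Theory.
Local Open Scope ring_scope.
Local Open Scope classical_set_scope.

(** The points of P^n over K are the lines through the origin of K^(n+1).
    Two values of type [{vspace _}] are equal iff they are the same subspace,
    so Leibniz equality on [proj_space K n] is equality of points. *)
Definition proj_space (K : fieldType) (n : nat) :=
  {L : {vspace 'rV[K]_n.+1} | \dim L == 1}.
HB.instance Definition _ (K : fieldType) (n : nat) :=
  Choice.on (proj_space K n).

(** A choice of homogeneous coordinates: a nonzero vector of the line. *)
Definition coords (K : fieldType) (n : nat) (p : proj_space K n) :
  'I_n.+1 -> K := vpick (val p) 0.

(** For homogeneous F, none of the notions below depends on the choice made
    by [coords]. *)
Definition hypersurface (K : fieldType) (n : nat) (F : {mpoly K[n.+1]}) :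
    set (proj_space K n) :=
  [set p | F.@[coords p] = 0].

Definition Sing (K : fieldType) (n : nat) (F : {mpoly K[n.+1]}) :
    set (proj_space K n) :=
  [set p | F.@[coords p] = 0 /\ forall i, (F^`M(i)).@[coords p] = 0].

(** Local equation at the point with homogeneous coordinates c, where
    c i != 0: dehomogenize F in the affine chart x_i = 1, whose n coordinates
    are the x_j / x_i for j != i, and translate the point to the origin. *)
Definition local_eq (K : fieldType) (n : nat) (F : {mpoly K[n.+1]})
    (c : 'I_n.+1 -> K) (i : 'I_n.+1) : {mpoly K[n]} :=
  F \mPo [tuple (if unlift i j is Some k then 'X_k + (c j / c i)%:MP else 1)
         | j < n.+1].

(** Order of vanishing at the origin: the least degree of a monomial of f.
    The order for which [mlast] is minimal refines the total degree. The value
    at f = 0 is irrelevant: [local_eq F c i] is nonzero if F is nonzero and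
    homogeneous. *)
Definition order_at_origin (K : fieldType) (n : nat) (f : {mpoly K[n]}) : nat :=
  mdeg (mlast f).

(** Multiplicity at p of the hypersurface F = 0, computed in some chart x_i = 1
    containing p; it does not depend on the chart. Partial derivatives would not
    compute it in positive characteristic. *)
Definition multiplicity (K : fieldType) (n : nat) (F : {mpoly K[n.+1]})
    (p : proj_space K n) : nat :=
  let c := coords p in
  if [pick i | c i != 0] is Some i then order_at_origin (local_eq F c i) else 0%N.

(* Main.v *)
Require Import Defs.
From mathcomp Require Import all_boot all_order all_algebra finmap.
From mathcomp Require Import mpoly.
From mathcomp Require Import boolp classical_sets cardinality.
From mathcomp Require Import fingroup perm zify ring.

Set Implicit Arguments.
Unset Strict Implicit.
Unset Printing Implicit Defensive.

Import GRing.Theory.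
Local Open Scope ring_scope.

(** Put the point p of multiplicity d - 1 at (1 : 0 : 0 : 0).  Then
    F = y A(w) + B(w), where w stands for the other three coordinates and A, B
    are plane forms of degrees d - 1 and d
    ([multiplicity_cone_form]).  A point (y : w) other than p is singular iff
    A(w) = B(w) = 0 and y dA + dB vanishes at w.  Thus, seen from p, the other
    singular points are points where the plane curves A = 0 and B = 0 meet
    without being transversal, and each such intersection counts at least twice
    in the d (d - 1) intersections allowed by Bezout.  The bound
    d (d - 1) / 2 follows, provided that

    - two singular points are never aligned with p.  Otherwise dA = dB = 0 at
      their common projection w, and the whole line through p and w, except
      possibly p, is singular;
    - A and B have no common component.  If A = C A' and B = C B', the surface
      is the union of the cone C = 0 and of y A' + B' = 0, and it is singular
      along their intersection, which is infinite.

    Finiteness of the singular locus enters both points in the same way: some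
    plane avoids p and all the singular points ([avoiding_hyperplane]).
    Replacing B by B - L A for a suitable linear form L makes this plane y = 0.
    Having no singular point with y = 0 then means that dB is nonzero at every
    common zero of A and B ([no_double_zero]), which is all that is used of
    finiteness.  The first exceptional case contradicts it at once; the second
    does because the plane curves C = 0 and B' = 0 meet ([common_zero]).

    The Bezout bound comes from the resultant R(t) of A(1, t, x) and
    B(1, t, x) with respect to x, in coordinates where (0 : 0 : 1) lies on
    neither curve and on none of the tangents to A = 0 at the points to be
    counted, and where these points have distinct t.  A weighted degree count in
    the Sylvester determinant gives deg R <= d (d - 1) ([resultant_top]).  Write
    R = u A + v B and restrict this identity to the line tangent to both curves
    at a point above t0: A and B vanish to order two there, and R does not
    depend on x, so (X - t0)^2 divides R ([tangency_bound]).  If R = 0, a greatest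
    common divisor in K[t][x], cleared of its factors in K[t] and made
    homogeneous again, is a common component ([common_component]).

    Derivatives enter only through the coefficient of s in F(w + s v), so no
    assumption on the characteristic is needed. *)

(** * Univariate and bivariate polynomials *)

Lemma poly_ext (K : closedFieldType) (p q : {poly K}) :
  (forall x, p.[x] = q.[x]) -> p = q.
Proof.
move=> epq; apply/eqP; rewrite -subr_eq0; apply: contraT => /closed_nonrootP[x].
by rewrite /root hornerD hornerN epq subrr eqxx.
Qed.

(** Identities between forms are proved on points; this version covers those
    whose proof divides by x. *)
Lemma poly_ext_neq0 (K : closedFieldType) (p q : {poly K}) :
  (forall x, x != 0 -> p.[x] = q.[x]) -> p = q.
Proof.
move=> epq; apply: (@mulIf {poly K} 'X); first by rewrite polyX_eq0.
 apply: poly_ext => x.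
rewrite !hornerM hornerX; have [->|/epq ->//] := eqVneq x 0.
by rewrite !mulr0.
Qed.

Lemma resultant_common_root (K : closedFieldType) (p q : {poly K}) :
  resultant p q = 0 -> exists x, root p x /\ root q x.
Proof.
move/eqP; rewrite resultant_eq0 => sg.
have /closed_rootP[x] : size (gcdp p q) != 1 by rewrite gtn_eqF.
by rewrite root_gcd => /andP[px qx]; exists x.
Qed.

Lemma dvdp_prod_XsubC_sqr (K : fieldType) (R : {poly K}) (ts : seq K) :
  uniq ts -> (forall t, t \in ts -> ('X - t%:P) ^+ 2 %| R) ->
  \prod_(t <- ts) ('X - t%:P) ^+ 2 %| R.
Proof.
elim: ts => [|t ts IH] /=; first by rewrite big_nil dvd1p.
move=> /andP[tts uts] dR; rewrite big_cons Gauss_dvdp; last first.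
  rewrite coprimep_expl // coprimep_sym coprimep_XsubC prodrXl.
  by rewrite /root horner_exp expf_eq0 -/(root _ _) root_prod_XsubC.
rewrite dR ?mem_head //= IH // => s sts.
by rewrite dR // inE sts orbT.
Qed.

Lemma size_prod_XsubC_sqr (K : fieldType) (ts : seq K) :
  size (\prod_(t <- ts) ('X - t%:P) ^+ 2) = (2 * size ts).+1.
Proof.
rewrite prodrXl; set p := \prod_(t <- ts) _.
have sp : size p = (size ts).+1 by rewrite size_prod_XsubC.
have p0 : p != 0 by rewrite -size_poly_eq0 sp.
by rewrite polySpred ?expf_neq0 // size_exp sp mulnC.
Qed.

Lemma horner_bivariate (R : comNzRingType) (f : {poly {poly R}}) (x t : R) :
  f.[x%:P].[t] = (map_poly (horner_eval t) f).[x].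
Proof.
by have := horner_map (horner_eval t) f x%:P; rewrite /= /horner_eval hornerC.
Qed.

(** General position is obtained from this lemma: all the open conditions on a
    point (1 : t : x) are multiplied into a single polynomial f. *)
Lemma bivariate_nonzero (K : closedFieldType) (f : {poly {poly K}}) :
  f != 0 -> exists t x, f.[x%:P].[t] != 0.
Proof.
move=> f0; have /closed_nonrootP[t] : lead_coef f != 0 by rewrite lead_coef_eq0.
move=> ft; have : map_poly (horner_eval t) f != 0.
  apply: contraNneq ft => /(congr1 (fun p : {poly K} => p`_(size f).-1)).
  by rewrite coef_map coef0 => /= /eqP.
move=> /closed_nonrootP[x fx]; exists t, x; apply: contraNneq fx.
by rewrite /root -horner_bivariate => ->.
Qed.

(** * Degree of a resultant *)

Lemma size_coefM_le (R : nzRingType) (p q : {poly R}) (k l : nat) :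
  (size p <= k.+1)%N -> (size q <= l.+1)%N -> (size (p * q)%R <= (k + l).+1)%N.
Proof. by move=> sp sq; apply: leq_trans (size_polyMleq _ _) _; lia. Qed.

Lemma coefM_top (R : nzRingType) (p q : {poly R}) (k l : nat) :
  (size p <= k.+1)%N -> (size q <= l.+1)%N -> (p * q)`_(k + l) = p`_k * q`_l.
Proof.
move=> sp sq; rewrite coefM (bigD1 (inord k)) //= inordK ?ltnS ?leq_addr //.
rewrite addKn big1 ?addr0 // => i; rewrite -val_eqE /= inordK ?ltnS ?leq_addr //.
move=> ik; have [lt_ki|le_ik] := ltnP k i.
  by rewrite nth_default ?mul0r // (leq_trans sp).
by rewrite [q`__]nth_default ?mulr0 // (leq_trans sq) //; lia.
Qed.

Lemma coef_prod_top (R : comNzRingType) (I : Type) (r : seq I)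
    (p : I -> {poly R}) (k : I -> nat) :
  (forall i, size (p i) <= (k i).+1)%N ->
  (size (\prod_(i <- r) p i)%R <= (\sum_(i <- r) k i).+1)%N /\
  (\prod_(i <- r) p i)`_(\sum_(i <- r) k i) = \prod_(i <- r) (p i)`_(k i).
Proof.
move=> sp; elim: r => [|i r [IHs IHc]].
  by rewrite !big_nil size_poly1 coef1.
rewrite !big_cons; split; first exact: size_coefM_le.
by rewrite coefM_top // IHc.
Qed.

(** If the (i, j) entry has degree at most w i - c j, every term of the Leibniz
    expansion has degree at most D = sum w - sum c, and its coefficient of
    degree D is the product of the top coefficients of its entries.  An entry
    with w i < c j is forced to be 0; this makes the truncated subtractions
    harmless. *)
Lemma det_top_coef (R : comNzRingType) (N : nat) (M : 'M[{poly R}]_N)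
    (w c : 'I_N -> nat) :
  (forall i j, size (M i j) <= (w i).+1 - c j)%N ->
  let D := (\sum_i w i - \sum_i c i)%N in
  (size (\det M) <= D.+1)%N /\
  (\det M)`_D = \det (\matrix_(i, j) (M i j)`_(w i - c j)).
Proof.
move=> sM D.
have perm_term (s : 'S_N) :
    (size (\prod_i M i (s i))%R <= D.+1)%N /\
    (\prod_i M i (s i))`_D = \prod_i (M i (s i))`_(w i - c (s i)).
  have [/forallP le_cw|] := boolP [forall i, (c (s i) <= w i)%N].
    have -> : D = (\sum_i (w i - c (s i)))%N.
      by rewrite sumnB // /D [X in (_ - X)%N](reindex_inj (@perm_inj _ s)).
    by apply: coef_prod_top => i; rewrite -subSn.
  (* The bound on the size of M i (s i) is 0, so the term vanishes. *)
  rewrite negb_forall => /existsP[i]; rewrite -ltnNge => lt_wc.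
  have M0 : M i (s i) = 0.
    by apply/eqP; rewrite -size_poly_leq0 (leq_trans (sM _ _)) // leqn0 subn_eq0.
  have -> : \prod_i M i (s i) = 0 by rewrite (bigD1 i) //= M0 mul0r.
  have -> : \prod_i (M i (s i))`_(w i - c (s i)) = 0.
    by rewrite (bigD1 i) //= M0 coef0 mul0r.
  by rewrite size_poly0 coef0.
split.
  apply: leq_trans (size_sum _ _ _) _; apply/bigmax_leqP => s _.
  by rewrite -[(-1) ^+ s]/(GRing.sign _ s) mulr_sign; case: (odd_perm s);
     rewrite ?size_polyN; case: (perm_term s).
rewrite coef_sum; apply: eq_bigr => s _.
rewrite !mulr_sign; have [_ Es] := perm_term s.
by case: (odd_perm s); rewrite ?coefN Es; [congr (- _)|];
  apply: eq_bigr => i _; rewrite mxE.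
Qed.

(** The sizes n and m are parameters, so that they can be replaced by equal
    expressions without a cast; in [Sylvester_mx] they are computed from p and
    q. *)
Definition Sylvester_dim (R : nzRingType) (n m : nat) (p q : {poly R}) :
    'M[R]_(n + m) :=
  \matrix_(i, j) match split i with
                 | inl k => p`_(j - k) *+ (k <= j)%N
                 | inr k => q`_(j - k) *+ (k <= j)%N
                 end.

Lemma resultantE (R : nzRingType) (p q : {poly R}) :
  resultant p q = \det (Sylvester_dim (size q).-1 (size p).-1 p q).
Proof.
by congr (\det _); apply/matrixP => i j; rewrite Sylvester_mxE mxE.
Qed.

(** Total degree at most m in t and x, for f in K[t][x] viewed as a polynomial
    in x. *)
Definition tdeg_le (R : nzRingType) (m : nat) (f : {poly {poly R}}) :=
  forall j, (size (f`_j)%R <= m.+1 - j)%N.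

(** The part of total degree m of f, with t = 1. *)
Definition top_form (R : nzRingType) (m : nat) (f : {poly {poly R}}) : {poly R} :=
  \poly_(j < m.+1) (f`_j)`_(m - j).

Lemma tdeg_le_size (R : nzRingType) (m : nat) (f : {poly {poly R}}) :
  tdeg_le m f -> (size f <= m.+1)%N.
Proof.
move=> gf; apply/leq_sizeP => j le_mj; apply/eqP; rewrite -size_poly_leq0.
by apply: leq_trans (gf j) _; rewrite leqn0 subn_eq0.
Qed.

Lemma coef_top_form (R : nzRingType) (m : nat) (f : {poly {poly R}}) j :
  tdeg_le m f -> (top_form m f)`_j = (f`_j)`_(m - j).
Proof.
move=> gf; rewrite coef_poly; case: ltnP => // le_mj.
by rewrite [f`_j]nth_default ?coef0 // (leq_trans (tdeg_le_size gf)).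
Qed.

(** The row of the Sylvester matrix holding the coefficients of x^k p gets
    weight m + k, the one holding those of x^k q gets weight n + k, and column j
    gets weight j.  The weights add up to m n.  Up to homogeneity, the
    coefficient of degree m n is the value of the resultant at the point at
    infinity of the t-line. *)
Lemma resultant_top (R : comNzRingType) (m n : nat) (p q : {poly {poly R}}) :
  size p = m.+1 -> size q = n.+1 -> tdeg_le m p -> tdeg_le n q ->
  size (top_form m p) = m.+1 -> size (top_form n q) = n.+1 ->
  (size (resultant p q) <= (m * n).+1)%N /\
  (resultant p q)`_(m * n) = resultant (top_form m p) (top_form n q).
Proof.
move=> sp sq gp gq sp' sq'; rewrite !resultantE sp sq sp' sq' /=.
pose w (i : 'I_(n + m)) :=
  match split i with inl k => m + k | inr k => n + k end%N.
have -> : (m * n = \sum_i w i - \sum_(i < n + m) i)%N.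
  rewrite !big_split_ord /=.
  rewrite (eq_bigr (fun i : 'I_n => m + i)%N); last first.
    by move=> i _; rewrite /w (unsplitK (inl i)).
  rewrite [X in (_ + X - _)%N](eq_bigr (fun i : 'I_m => n + i)%N); last first.
    by move=> i _; rewrite /w (unsplitK (inr i)).
  rewrite !big_split /= !sum_nat_const !card_ord; lia.
have sM i j : (size (Sylvester_dim n m p q i j) <= (w i).+1 - j)%N.
  rewrite mxE /w; case: (split i) => k; case: (leqP k j) => [le_kj|_];
    rewrite ?mulr0n ?size_poly0 //= ?mulr1n.
  - by apply: leq_trans (gp _) _; lia.
  - by apply: leq_trans (gq _) _; lia.
have [sD ->] := det_top_coef sM; split=> //.
congr (\det _); apply/matrixP => i j; rewrite !mxE /w.
case: (split i) => k; case: (leqP k j) => [le_kj|_]; rewrite ?mulr0n ?coef0 //= ?mulr1n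
  coef_top_form //; congr (_`_ _); lia.
Qed.

Lemma top_formM (R : idomainType) (k l : nat) (f g : {poly {poly R}}) :
  tdeg_le k f -> tdeg_le l g ->
  top_form (k + l) (f * g) = top_form k f * top_form l g.
Proof.
move=> gf gg; apply/polyP => j; rewrite coef_poly coefM; case: ltnP => [le_j|lt_j].
  rewrite coefM coef_sum; apply: eq_bigr => i _; rewrite !coef_top_form //.
  have [le_ik|lt_ki] := leqP i k; last first.
    have -> : f`_i = 0.
      by rewrite nth_default // (leq_trans (tdeg_le_size gf)).
    by rewrite mul0r !coef0 mul0r.
  have [le_jl|lt_lj] := leqP (j - i) l; last first.
    have -> : g`_(j - i) = 0.
      by rewrite nth_default // (leq_trans (tdeg_le_size gg)).
    by rewrite mulr0 !coef0 mulr0.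
  have -> : (k + l - j = (k - i) + (l - (j - i)))%N by have := ltn_ord i; lia.
  by rewrite coefM_top // -subSn.
rewrite big1 // => i _.
have [le_ik|lt_ki] := leqP i k; last first.
  by rewrite nth_default ?mul0r // (leq_trans (size_poly _ _)).
rewrite mulrC nth_default ?mul0r // (leq_trans (size_poly _ _)) //.
by have := ltn_ord i; lia.
Qed.

Lemma exists_tdeg (R : nzRingType) (f : {poly {poly R}}) :
  f != 0 -> exists2 k, tdeg_le k f & top_form k f != 0.
Proof.
move=> f0.
have [N gN] : exists N, tdeg_le N f.
  pose M := (\max_(i < size f) size (f`_i)%R)%N.
  exists (size f + M)%N => j.
  have [lt_j|le_j] := ltnP j (size f); last by rewrite nth_default // size_poly0.
  have : (size (f`_j)%R <= M)%N.
    exact: (@leq_bigmax _ (fun i : 'I_(size f) => size (f`_i)%R) (Ordinal lt_j)).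
  lia.
elim: N gN => [|N IH] gN.
  exists 0%N => //; apply: contra_neq f0 => t0; apply/polyP => -[|j].
    have := gN 0%N; rewrite subn0 => /size1_polyC ->.
    by have := coef_top_form 0 gN; rewrite t0 !coef0 subn0 => <-.
  by apply/eqP; rewrite coef0 -size_poly_leq0; apply: gN.
have [t0|] := eqVneq (top_form N.+1 f) 0; last by exists N.+1.
apply: IH => j; have [le_j|lt_j] := leqP j N.+1; last first.
  by apply: leq_trans (gN j) _; lia.
have := coef_top_form j gN; rewrite t0 coef0 => /esym cj.
apply/leq_sizeP => i le_i; have [->//|ne_i] := eqVneq i (N.+1 - j)%N.
by apply/(leq_sizeP _ _ (gN j)); lia.
Qed.

(** The total degree is additive, since top forms multiply.  Here f and g have
    total degree at least their degree in x, and the sum of the latter bounds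
    the total degree of the product; both inequalities must be equalities. *)
Lemma tdeg_le_factors (R : idomainType) (f g : {poly {poly R}}) :
  f * g != 0 -> tdeg_le ((size f).-1 + (size g).-1) (f * g) ->
  tdeg_le (size f).-1 f /\ tdeg_le (size g).-1 g.
Proof.
move=> fg0 gfg; move: (fg0); rewrite mulf_eq0 negb_or => /andP[f0 g0].
have [k gf tf] := exists_tdeg f0; have [l gg tg] := exists_tdeg g0.
have sf := tdeg_le_size gf; have sg := tdeg_le_size gg.
have sf0 : (0 < size f)%N by rewrite size_poly_gt0.
have sg0 : (0 < size g)%N by rewrite size_poly_gt0.
suff le_kl : (k + l <= (size f).-1 + (size g).-1)%N.
  have [-> ->] // : (size f).-1 = k /\ (size g).-1 = l.
  move: le_kl sf sg sf0 sg0; move: (size f) (size g) => a b; lia.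
rewrite leqNgt; apply: contraT => lt_kl; move: (mulf_neq0 tf tg).
rewrite -top_formM // => /negP[]; apply/eqP/polyP => j.
rewrite coef0 coef_poly; case: ltnP => // le_j.
by apply/(leq_sizeP _ _ (gfg j)); lia.
Qed.

(** * Common factors in K[t][x] *)

Definition specialize (K : fieldType) (t : K) (f : {poly {poly K}}) : {poly K} :=
  map_poly (horner_eval t) f.

(** Over an algebraically closed field, f has no nonconstant factor in K[t] iff
    no specialization of t kills it. *)
Definition primitive_poly (K : fieldType) (f : {poly {poly K}}) :=
  forall t, specialize t f != 0.

Lemma specialize_eq0 (K : fieldType) (t : K) (f : {poly {poly K}}) :
  specialize t f = 0 -> exists f', f = ('X - t%:P) *: f'.
Proof.
move=> f0; exists (map_poly (fun p => p %/ ('X - t%:P)) f).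
apply/polyP => j; rewrite coefZ coef_map_id0 ?div0p // mulrC divpK //.
rewrite dvdp_XsubCl; have := congr1 (fun p : {poly K} => p`_j) f0.
by rewrite coef0 coef_map => /eqP.
Qed.

Lemma specializeM (K : fieldType) (t : K) (f g : {poly {poly K}}) :
  specialize t (f * g) = specialize t f * specialize t g.
Proof. exact: rmorphM. Qed.

Lemma specializeZ (K : fieldType) (t : K) (h : {poly K}) (f : {poly {poly K}}) :
  specialize t (h *: f) = h.[t] *: specialize t f.
Proof. exact: map_polyZ. Qed.

Lemma primitive_part (K : fieldType) (f : {poly {poly K}}) :
  f != 0 -> exists h f', [/\ h != 0, f = h *: f' & primitive_poly f'].
Proof.
have [n] := ubnP (size (lead_coef f)); elim: n f => // n IH f le_fn f0.
have [pf|] := pselect (primitive_poly f).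
  by exists 1, f; rewrite oner_neq0 scale1r.
move=> /existsNP[t /negP]; rewrite negbK => /eqP /specialize_eq0[f1 Ef].
have f10 : f1 != 0 by apply: contra_neq f0 => f10; rewrite Ef f10 scaler0.
have lt_f1 : (size (lead_coef f1) < n)%N.
  move: le_fn; rewrite Ef lead_coefZ mulrC size_Mmonic ?monicXsubC //.
    by rewrite size_XsubC addn2.
  by rewrite lead_coef_eq0.
have [h [f' [h0 Ef1 pf']]] := IH f1 lt_f1 f10.
exists (('X - t%:P) * h), f'; split=> //.
  by rewrite mulf_neq0 // polyXsubC_eq0.
by rewrite -scalerA -Ef1.
Qed.

(** Gauss's lemma.  At a root t of l the product r c vanishes, hence so does r as
    K[x] is an integral domain and c is primitive.  Dividing l and r by X - t
    lowers the degree of l. *)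
Lemma primitive_cancel (K : closedFieldType) (c p r : {poly {poly K}})
    (l : {poly K}) :
  primitive_poly c -> l != 0 -> l *: p = r * c -> exists p', p = p' * c.
Proof.
move=> pc; have [n] := ubnP (size l); elim: n l r => // n IH l r le_ln l0 Ep.
have [/eqP/size_poly1P[a a0 El]|/closed_rootP[t lt]] := eqVneq (size l) 1%N.
  exists (a^-1%:P *: r); rewrite -scalerAl -Ep El scalerA -polyCM mulVf //.
  by rewrite scale1r.
have /eqP : specialize t (r * c) = 0.
  by rewrite -Ep specializeZ (rootP lt) scale0r.
rewrite specializeM mulf_eq0 (negPf (pc t)) orbF => /eqP/specialize_eq0[r1 Er].
have /factor_theorem[l1 El] := lt.
have l10 : l1 != 0 by apply: contra_neq l0 => l10; rewrite El l10 mul0r.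
apply: (IH l1 r1) => //.
  by move: le_ln; rewrite El size_Mmonic ?monicXsubC // size_XsubC addn2 ltnS.
apply: (@mulfI _ ('X - t%:P)%:P); first by rewrite polyC_eq0 polyXsubC_eq0.
by rewrite !mul_polyC scalerA mulrC -El Ep Er -scalerAl.
Qed.

(** The greatest common divisor divides p and q only up to a factor in K[t].
    Its primitive part divides them in K[t][x]. *)
Lemma common_factor (K : closedFieldType) (p q : {poly {poly K}}) :
  p != 0 -> resultant p q = 0 ->
  exists c p' q' : {poly {poly K}}, [/\ (1 < size c)%N, p = p' * c & q = q' * c].
Proof.
move=> p0 /eqP; rewrite resultant_eq0 => sg.
have g0 : gcdp p q != 0 by rewrite gcdp_eq0 negb_and p0.
have [h [c [h0 Eg pc]]] := primitive_part g0.
have [[l r] /= l0 El] := Pdiv.Idomain.dvdpP _ _ (dvdp_gcdl p q).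
have [[l' r'] /= l'0 El'] := Pdiv.Idomain.dvdpP _ _ (dvdp_gcdr p q).
have [p' Ep] : exists p', p = p' * c.
  by apply: (primitive_cancel pc l0 (r := h *: r)); rewrite El Eg -scalerAr scalerAl.
have [q' Eq] : exists q', q = q' * c.
  by apply: (primitive_cancel pc l'0 (r := h *: r')); rewrite El' Eg -scalerAr scalerAl.
by exists c, p', q'; split=> //; move: sg; rewrite Eg size_scale.
Qed.

(** * Ternary forms and their affine equations *)

Local Notation o0 := (@Ordinal 3 0 isT).
Local Notation o1 := (@Ordinal 3 1 isT).
Local Notation o2 := (@Ordinal 3 2 isT).

Lemma ord3P (P : 'I_3 -> Prop) : P o0 -> P o1 -> P o2 -> forall i, P i.
Proof.
move=> P0 P1 P2 [[|[|[|//]]] lt_i].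
- by rewrite (_ : Ordinal _ = o0) //; apply: val_inj.
- by rewrite (_ : Ordinal _ = o1) //; apply: val_inj.
- by rewrite (_ : Ordinal _ = o2) //; apply: val_inj.
Qed.

Lemma big_ord3 (R : Type) (idx : R) (op : Monoid.law idx) (F : 'I_3 -> R) :
  \big[op/idx]_(i < 3) F i = op (F o0) (op (F o1) (F o2)).
Proof.
rewrite !big_ord_recl big_ord0 Monoid.mulm1.
by congr (op (F _) (op (F _) (F _))); apply: val_inj.
Qed.

Definition pt3 (T : Type) (a b c : T) (i : 'I_3) : T := nth a [:: a; b; c] i.

Definition mon3 (a b c : nat) : 'X_{1..3} := [multinom pt3 a b c i | i < 3].

Lemma mdeg3 (m : 'X_{1..3}) : mdeg m = (m o0 + (m o1 + m o2))%N.
Proof. by rewrite mdegE big_ord3. Qed.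

Lemma mdeg_mon3 a b c : mdeg (mon3 a b c) = (a + (b + c))%N.
Proof. by rewrite mdeg3 !mnmE. Qed.

Lemma mnm3P (m m' : 'X_{1..3}) :
  m o0 = m' o0 -> m o1 = m' o1 -> m o2 = m' o2 -> m = m'.
Proof. by move=> e0 e1 e2; apply/mnmP; apply: ord3P. Qed.

Lemma dhomog_mdeg (n : nat) (R : nzRingType) (d : nat) (F : {mpoly R[n]}) x :
  F \is d.-homog -> x \in msupp F -> mdeg x = d.
Proof. by move=> hF; apply: (dhomog_mf hF). Qed.

Section Dehomogenize.
Variable K : fieldType.
Implicit Types (A B : {mpoly K[3]}) (f : {poly {poly K}}).

(** The equation A(1, t, x) of the affine part, as an element of K[t][x]. *)
Definition dehom A : {poly {poly K}} :=
  mmap (polyC \o polyC) (pt3 1 'X%:P 'X) A.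

Lemma dehomM A B : dehom (A * B) = dehom A * dehom B.
Proof. exact: rmorphM. Qed.

Lemma coef_dehom A i j :
  (dehom A)`_j`_i =
    \sum_(m <- msupp A) A@_m * ((m o1 == i) && (m o2 == j))%:R.
Proof.
rewrite /dehom /mmap !coef_sum; apply: eq_bigr => m _.
rewrite /mmap1 big_ord3 /pt3 /= expr1n mul1r -polyC_exp !coefCM.
rewrite coefXn [j == _]eq_sym; case: eqP => _; last by rewrite !mulr0 coef0 andbF mulr0.
by rewrite mulr1 coefXn andbT eq_sym.
Qed.

Lemma coef_dehom_homog m A i j : A \is m.-homog ->
  (dehom A)`_j`_i = if (i + j <= m)%N then A@_(mon3 (m - (i + j)) i j) else 0.
Proof.
move=> hA; rewrite coef_dehom; case: leqP => [le_ij|lt_m]; last first.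
  rewrite big_seq big1 // => m' /(dhomog_mdeg hA); rewrite mdeg3 => Em.
  case: andP => [[/eqP E1 /eqP E2]|_]; [lia|exact: mulr0].
rewrite [X in _ = mcoeff _ X](mpolyE A) raddf_sum /=.
rewrite big_seq [in RHS]big_seq; apply: eq_bigr => m' /(dhomog_mdeg hA).
rewrite mdeg3 mcoeffZ mcoeffX => Em; congr (_ * _%:R); congr nat_of_bool.
apply/andP/eqP => [[/eqP E1 /eqP E2]|->]; last by rewrite !mnmE.
by apply: mnm3P; rewrite !mnmE /pt3 //=; lia.
Qed.

Lemma tdeg_le_dehom m A : A \is m.-homog -> tdeg_le m (dehom A).
Proof.
move=> hA j; apply/leq_sizeP => i le_i; rewrite (coef_dehom_homog _ _ hA).
by case: leqP => //; lia.
Qed.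

Definition homogenize (m : nat) f : {mpoly K[3]} :=
  \sum_(x : 'X_{1..3 < m.+1})
    (if mdeg x == m then f`_(x o2)`_(x o1) else 0) *: 'X_[x].

Lemma mcoeff_homogenize m f x :
  (homogenize m f)@_x = if mdeg x == m then f`_(x o2)`_(x o1) else 0.
Proof.
have [lt_x|le_x] := ltnP (mdeg x) m.+1.
  exact: (mcoeff_mpoly (fun x : 'X_{1..3} =>
    if mdeg x == m then f`_(x o2)`_(x o1) else 0)).
rewrite gtn_eqF // /homogenize raddf_sum big1 //= => -[y lt_y] _ /=.
rewrite mcoeffZ mcoeffX; case: (_ =P x) => [E|_]; last exact: mulr0.
by move: lt_y; rewrite E ltnNge le_x.
Qed.

Lemma homogenize_homog m f : homogenize m f \is m.-homog.
Proof.
apply/dhomogP => x; rewrite mcoeff_msupp mcoeff_homogenize.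
by case: (mdeg x =P m) => [//|_]; rewrite eqxx.
Qed.

(** Together with [dehomK]: forms of degree m correspond to the polynomials of
    K[t][x] of total degree at most m. *)
Lemma homogenizeK m f : tdeg_le m f -> dehom (homogenize m f) = f.
Proof.
move=> gf; apply/polyP => j; apply/polyP => i.
rewrite (coef_dehom_homog _ _ (homogenize_homog _ _)) mcoeff_homogenize.
rewrite mdeg_mon3 !mnmE /pt3 /=; case: leqP => [le_m|lt_m].
  by rewrite subnK // eqxx.
by apply/esym/(leq_sizeP _ _ (gf j)); lia.
Qed.

Lemma dehomK m A : A \is m.-homog -> homogenize m (dehom A) = A.
Proof.
move=> hA; apply/mpolyP => x; rewrite mcoeff_homogenize; case: eqP => [E|ne].
  rewrite (coef_dehom_homog _ _ hA); move: (E); rewrite mdeg3 => E'.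
  case: leqP => [le_m|]; last by lia.
  by congr (_@__); apply: mnm3P; rewrite !mnmE /pt3 //=; lia.
by rewrite (dhomog_nemf_coeff hA) //; apply/eqP.
Qed.

Lemma horner_dehom A (x : {poly K}) (u : K) :
  (dehom A).[x].[u] = A.@[pt3 1 u x.[u]].
Proof.
rewrite /dehom /mmap mevalE horner_sum horner_sum; apply: eq_bigr => m _.
rewrite /mmap1 !big_ord3 /pt3 /= !expr1n !mul1r !hornerE.
by [].
Qed.

Lemma dehom_neq0 m A : A \is m.-homog -> A != 0 -> dehom A != 0.
Proof.
move=> hA; apply: contra_neq => d0; rewrite -(dehomK hA) d0.
by apply/mpolyP => x; rewrite mcoeff_homogenize !coef0 mcoeff0 if_same.
Qed.

(** The top form cuts out the points of the curve on the line at infinity. *)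
Lemma top_form_dehom m A x : A \is m.-homog ->
  (top_form m (dehom A)).[x] = A.@[pt3 0 1 x].
Proof.
move=> hA; rewrite horner_poly mevalE.
under eq_bigr => j _ do rewrite coef_dehom mulr_suml.
rewrite exchange_big /= big_seq [in RHS]big_seq.
apply: eq_bigr => y /(dhomog_mdeg hA); rewrite mdeg3 => Ey.
rewrite big_ord3 /pt3 /= expr1n mul1r.
have lt_y : (y o2 < m.+1)%N by lia.
rewrite (bigD1 (Ordinal lt_y)) //= eqxx andbT big1 ?addr0 => [|j]; last first.
  by rewrite -val_eqE /= eq_sym => /negPf->; rewrite andbF mulr0 mul0r.
rewrite expr0n -mulrA; congr (_ * (_%:R * _)); congr nat_of_bool; lia.
Qed.

Lemma lead_dehom m A : A \is m.-homog -> (dehom A)`_m = (A.@[pt3 0 0 1])%:P.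
Proof.
move=> hA; apply/polyP => i; rewrite coefC coef_dehom mevalE.
case: eqP => [->|ne_i].
  rewrite big_seq [in RHS]big_seq; apply: eq_bigr => y /(dhomog_mdeg hA).
  rewrite mdeg3 big_ord3 /pt3 /= expr1n mulr1 !expr0n -natrM mulnb => Ey.
  by congr (_ * _%:R); congr nat_of_bool; lia.
rewrite big_seq big1 // => y /(dhomog_mdeg hA); rewrite mdeg3 => Ey.
by case: andP => [[/eqP E1 /eqP E2]|_]; [lia|exact: mulr0].
Qed.

End Dehomogenize.

(** * Directional derivatives *)

Section DirectionalDerivative.
Variables (K : fieldType) (n : nat).
Implicit Types (F G : {mpoly K[n]}) (w v : 'I_n -> K).

(** The restriction F(w + s v) to a line, as a polynomial in s. *)
Definition along w v F : {poly K} :=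
  mmap polyC (fun i => (w i)%:P + v i *: 'X) F.

Definition ddir w v F : K := \sum_i v i * (F^`M(i)).@[w].

Lemma horner_along w v F s : (along w v F).[s] = F.@[fun i => w i + s * v i].
Proof.
rewrite /along /mmap mevalE horner_sum; apply: eq_bigr => m _.
rewrite hornerM hornerC /mmap1 horner_prod; congr (_ * _).
by apply: eq_bigr => i _; rewrite horner_exp !hornerE mulrC.
Qed.

Lemma along_coef0 w v F : (along w v F)`_0 = F.@[w].
Proof.
by rewrite -horner_coef0 horner_along; apply: meval_eq => i; rewrite mul0r addr0.
Qed.

Lemma ddirM w v F G :
  ddir w v (F * G) = ddir w v F * G.@[w] + F.@[w] * ddir w v G.
Proof.
rewrite /ddir mulr_suml mulr_sumr -big_split; apply: eq_bigr => i _ /=.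
by rewrite mderivM mevalD !mevalM mulrDr mulrA mulrCA.
Qed.

Lemma ddirD w v F G : ddir w v (F + G) = ddir w v F + ddir w v G.
Proof.
rewrite /ddir -big_split; apply: eq_bigr => i _ /=.
by rewrite mderivD mevalD mulrDr.
Qed.

Lemma ddirC w v c : ddir w v c%:MP = 0.
Proof. by rewrite /ddir big1 // => i _; rewrite mderivC meval0 mulr0. Qed.

Lemma ddirX w v i : ddir w v 'X_i = v i.
Proof.
rewrite /ddir (bigD1 i) //= big1 => [|j ne_ji]; rewrite mderivX mnm1E.
  have -> : (U_(i) - U_(i) = 0)%MM by apply/mnmP => k; rewrite mnmBE subnn mnm0E.
  by rewrite eqxx scale1r mpolyX0 meval1 mulr1 addr0.
by rewrite eq_sym (negPf ne_ji) scale0r meval0 mulr0.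
Qed.

(** Both sides are derivations at w.  This reduces the chain rule for linear
    substitutions to an identity between polynomial functions of s. *)
Lemma along_coef1 w v F : (along w v F)`_1 = ddir w v F.
Proof.
pose P G := (along w v G)`_1 = ddir w v G.
have PC c : P c%:MP by rewrite /P ddirC /along mmapC coefC.
have PM G H : P G -> P H -> P (G * H).
  rewrite /P ddirM => PG PH; rewrite {1}/along rmorphM /= -!/(along _ _ _).
  rewrite coefM big_ord_recl big_ord1 /= !along_coef0 PG PH.
  by rewrite [RHS]addrC.
have PD G H : P G -> P H -> P (G + H).
  by rewrite /P ddirD => PG PH; rewrite {1}/along rmorphD /= coefD PG PH.
have PX i : P 'X_i.
  rewrite /P ddirX /along mmapX mmap1U coefD coefC coefZ coefX /=.
  by rewrite add0r mulr1.
rewrite -/(P F) [F]mpolyE; elim/big_ind: _; [by rewrite -mpolyC0|exact: (PD)|].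
move=> m _; rewrite -mul_mpolyC; apply: (PM) => //; rewrite mpolyXE_id.
elim/big_ind: _ => [||i _]; [by rewrite -mpolyC1|exact: (PM)|].
elim: (m i) => [|k IH]; first by rewrite expr0 -mpolyC1.
by rewrite exprS; apply: (PM).
Qed.

Lemma ddirZ w v F c : ddir w (fun i => c * v i) F = c * ddir w v F.
Proof. by rewrite /ddir mulr_sumr; apply: eq_bigr => i _; rewrite mulrA. Qed.

Lemma ddir_dirD w v u F :
  ddir w (fun i => v i + u i) F = ddir w v F + ddir w u F.
Proof. by rewrite /ddir -big_split; apply: eq_bigr => i _; rewrite /= mulrDl. Qed.

Lemma eq_ddir w w' v v' F : w =1 w' -> v =1 v' -> ddir w v F = ddir w' v' F.
Proof.
by move=> ew ev; apply: eq_bigr => i _; rewrite ev (meval_eq _ ew).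
Qed.

Lemma along_dvd_sqr w v F :
  F.@[w] = 0 -> ddir w v F = 0 -> 'X ^+ 2 %| along w v F.
Proof.
rewrite -(along_coef0 w v) -along_coef1 => c0 c1.
have -> : along w v F = drop_poly 2 (along w v F) * 'X^2.
  rewrite -[LHS](poly_take_drop 2); suff -> : take_poly 2 (along w v F) = 0.
    by rewrite add0r.
  apply/polyP => j; rewrite coef_take_poly coef0.
  by case: j => [|[|j]] //=.
by rewrite dvdp_mull.
Qed.

Lemma meval_homogZ d F c w :
  F \is d.-homog -> F.@[fun i => c * w i] = c ^+ d * F.@[w].
Proof.
move=> hF; rewrite !mevalE mulr_sumr big_seq [RHS]big_seq; apply: eq_bigr => m.
move=> /(dhomog_mdeg hF) Em; under eq_bigr do rewrite exprMn.
by rewrite big_split /= prodrXr -mdegE Em mulrCA.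
Qed.

End DirectionalDerivative.

Lemma ddir_homogZ (K : closedFieldType) n d (F : {mpoly K[n]}) c w v :
  F \is d.-homog ->
  ddir (fun i => c * w i) (fun i => c * v i) F = c ^+ d * ddir w v F.
Proof.
move=> hF; rewrite -!along_coef1.
suff -> : along (fun i => c * w i) (fun i => c * v i) F = c ^+ d *: along w v F.
  by rewrite coefZ.
apply: poly_ext => s; rewrite hornerZ !horner_along -(meval_homogZ _ _ hF).
by apply: meval_eq => i; rewrite mulrDr mulrCA.
Qed.

Lemma ddir_delta (K : fieldType) n (F : {mpoly K[n]}) w k :
  ddir w (fun i => (i == k)%:R) F = (F^`M(k)).@[w].
Proof.
rewrite /ddir (bigD1 k) //= eqxx mul1r big1 ?addr0 // => j /negPf->.
exact: mul0r.
Qed.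

Lemma ddir_eq0P (K : fieldType) n (F : {mpoly K[n]}) w :
  (forall v, ddir w v F = 0) <-> (forall i, (F^`M(i)).@[w] = 0).
Proof.
split=> [dF i|dF v]; last by rewrite /ddir big1 // => i _; rewrite dF mulr0.
by rewrite -ddir_delta.
Qed.

(** * Intersection of two plane curves *)

Section PlaneCurves.
Variable K : closedFieldType.
Implicit Types (A B : {mpoly K[3]}) (w : 'I_3 -> K).

Lemma size_dehom m A :
  A \is m.-homog -> A.@[pt3 0 0 1] != 0 -> size (dehom A) = m.+1.
Proof.
move=> hA A3; apply/eqP; rewrite eqn_leq (tdeg_le_size (tdeg_le_dehom hA)) /=.
rewrite ltnNge; apply: contra A3 => /leq_sizeP/(_ _ (leqnn m)).
by rewrite (lead_dehom hA) => /eqP; rewrite polyC_eq0.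
Qed.

Lemma size_top_form_dehom m A :
  A \is m.-homog -> A.@[pt3 0 0 1] != 0 -> size (top_form m (dehom A)) = m.+1.
Proof.
move=> hA A3; apply/eqP; rewrite eqn_leq size_poly ltnNge.
apply: contra A3 => /leq_sizeP/(_ _ (leqnn m)).
rewrite (coef_top_form _ (tdeg_le_dehom hA)) (lead_dehom hA) subnn.
by rewrite coefC eqxx => ->.
Qed.

Lemma resultant_dehom_bound m n A B :
  A \is m.-homog -> B \is n.-homog ->
  A.@[pt3 0 0 1] != 0 -> B.@[pt3 0 0 1] != 0 ->
  (size (resultant (dehom A) (dehom B)) <= (m * n).+1)%N /\
  (resultant (dehom A) (dehom B))`_(m * n) =
    resultant (top_form m (dehom A)) (top_form n (dehom B)).
Proof.
move=> hA hB A3 B3.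
apply: resultant_top; by [exact: size_dehom | exact: tdeg_le_dehom
  | exact: size_top_form_dehom].
Qed.

(** If R(t) has a root, the curves meet above it.  Otherwise R is a constant, so
    its coefficient of degree m n > 0 vanishes; this coefficient is the resultant
    of the top forms, and the curves meet on the line at infinity. *)
Lemma common_zero m n A B :
  A \is m.-homog -> B \is n.-homog ->
  A.@[pt3 0 0 1] != 0 -> B.@[pt3 0 0 1] != 0 -> (0 < m)%N -> (0 < n)%N ->
  exists w, [/\ exists i, w i != 0, A.@[w] = 0 & B.@[w] = 0].
Proof.
move=> hA hB A3 B3 m0 n0; set R := resultant (dehom A) (dehom B).
have [_ Rtop] := resultant_dehom_bound hA hB A3 B3.
have [sR|/closed_rootP[t Rt]] := eqVneq (size R) 1%N.
  have [|x [Ax Bx]] := @resultant_common_root _ (top_form m (dehom A))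
      (top_form n (dehom B)).
    by rewrite -Rtop nth_default // sR muln_gt0 m0.
  exists (pt3 0 1 x); split; first by exists o1; apply: oner_neq0.
    by rewrite -(top_form_dehom _ hA); apply/rootP.
  by rewrite -(top_form_dehom _ hB); apply/rootP.
have lead C k : C \is k.-homog -> C.@[pt3 0 0 1] != 0 ->
    horner_eval t (lead_coef (dehom C)) != 0.
  move=> hC C3; rewrite lead_coefE (size_dehom hC C3) (lead_dehom hC).
  by rewrite /horner_eval hornerC.
have [|x [Ax Bx]] := @resultant_common_root _ (specialize t (dehom A))
    (specialize t (dehom B)).
  by rewrite -(map_resultant (lead _ _ hA A3) (lead _ _ hB B3)); apply/rootP.
exists (pt3 1 t x); split; first by exists o0; apply: oner_neq0.
  by rewrite -[x in pt3 _ _ x](hornerC x t) -horner_dehom horner_bivariate; apply/rootP.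
by rewrite -[x in pt3 _ _ x](hornerC x t) -horner_dehom horner_bivariate; apply/rootP.
Qed.

(** As (0 : 0 : 1) is not on A = 0, the degree of A(1, t, x) in x is equal to its
    total degree.  The same then holds for its factors, which can be homogenized
    without raising the degree of their product. *)
Lemma common_component m n A B :
  A \is m.-homog -> B \is n.-homog ->
  A.@[pt3 0 0 1] != 0 -> B.@[pt3 0 0 1] != 0 ->
  resultant (dehom A) (dehom B) = 0 ->
  exists k C A' B', [/\ (0 < k <= m)%N, C \is k.-homog, B' \is (n - k).-homog,
    A = C * A' & B = C * B'].
Proof.
move=> hA hB A3 B3 R0.
have sA := size_dehom hA A3; have sB := size_dehom hB B3.
have pA0 : dehom A != 0 by rewrite -size_poly_eq0 sA.
have pB0 : dehom B != 0 by rewrite -size_poly_eq0 sB.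
have [c [p [q [sc Ep Eq]]]] := common_factor pA0 R0.
have factor l D f : D \is l.-homog -> size (dehom D) = l.+1 -> dehom D = f * c ->
    [/\ (size f).-1 + (size c).-1 = l, tdeg_le (size f).-1 f &
        tdeg_le (size c).-1 c]%N.
  move=> hD sD ED; have fc0 : f * c != 0 by rewrite -ED -size_poly_eq0 sD.
  move: (fc0); rewrite mulf_eq0 negb_or => /andP[f0 c0].
  have El : ((size f).-1 + (size c).-1 = l)%N.
    have := size_mul f0 c0; rewrite -ED sD => El.
    have : (0 < size f)%N by rewrite size_poly_gt0.
    move: El sc; move: (size f) (size c) => a b; lia.
  have [gf gc] : tdeg_le (size f).-1 f /\ tdeg_le (size c).-1 c.
    by apply: (tdeg_le_factors fc0); rewrite El -ED; apply: tdeg_le_dehom.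
  by split.
have [Em gp gc] := factor _ _ _ hA sA Ep.
have [En gq _] := factor _ _ _ hB sB Eq.
set k := (size c).-1 in Em En gc.
have split_form l D f : D \is l.-homog -> dehom D = f * c ->
    ((size f).-1 + k = l)%N -> tdeg_le (size f).-1 f ->
    D = homogenize k c * homogenize (size f).-1 f.
  move=> hD ED El gf; rewrite -(dehomK hD) -[RHS](@dehomK _ l).
    by rewrite dehomM !homogenizeK // ED mulrC.
  by rewrite -El addnC; apply: dhomogM; apply: homogenize_homog.
exists k, (homogenize k c), (homogenize (size p).-1 p), (homogenize (size q).-1 q).
split; [| exact: homogenize_homog | | exact: split_form hA Ep Em gp
  | exact: split_form hB Eq En gq].
  have -> : (0 < k)%N by rewrite /k -subn1 subn_gt0.
  by move: Em; move: (size p).-1 => a <-; apply: leq_addl.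
by rewrite -En addnK; apply: homogenize_homog.
Qed.

(** The line x + kappa (t' - t), where t' varies, touches the curve at (t, x). *)
Lemma tangent_dvd_sqr A (t x kappa : K) :
  A.@[pt3 1 t x] = 0 -> ddir (pt3 1 t x) (pt3 0 1 kappa) A = 0 ->
  ('X - t%:P) ^+ 2 %| (dehom A).[x%:P + kappa *: ('X - t%:P)].
Proof.
move=> A0 dA0.
have -> : (dehom A).[x%:P + kappa *: ('X - t%:P)] =
    along (pt3 1 t x) (pt3 0 1 kappa) A \Po ('X - t%:P).
  apply: poly_ext => u; rewrite horner_dehom horner_comp horner_along.
  apply: meval_eq; apply: ord3P; rewrite /pt3 /=
    !(hornerD, hornerN, hornerZ, hornerC, hornerX); ring.
rewrite -comp_Xn_poly; apply: dvdp_comp_poly; exact: along_dvd_sqr.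
Qed.

(** Bezout's bound for intersections of multiplicity two: the resultant lies in
    the ideal generated by both equations, which vanish to order two along a
    common tangent. *)
Lemma tangency_bound m n A B N (t x kappa : 'I_N -> K) :
  A \is m.-homog -> B \is n.-homog ->
  A.@[pt3 0 0 1] != 0 -> B.@[pt3 0 0 1] != 0 -> (0 < m)%N -> (0 < n)%N ->
  resultant (dehom A) (dehom B) != 0 -> injective t ->
  (forall j, A.@[pt3 1 (t j) (x j)] = 0) ->
  (forall j, B.@[pt3 1 (t j) (x j)] = 0) ->
  (forall j, ddir (pt3 1 (t j) (x j)) (pt3 0 1 (kappa j)) A = 0) ->
  (forall j, ddir (pt3 1 (t j) (x j)) (pt3 0 1 (kappa j)) B = 0) ->
  (2 * N <= m * n)%N.
Proof.
move=> hA hB A3 B3 m0 n0 R0 t_inj A0 B0 dA dB.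
have [sR _] := resultant_dehom_bound hA hB A3 B3.
have [|| [u v] _ /= ER] := @resultant_in_ideal _ (dehom A) (dehom B).
- by rewrite (size_dehom hA A3).
- by rewrite (size_dehom hB B3).
set R := resultant _ _ in R0 sR ER.
have dR s : s \in codom t -> ('X - s%:P) ^+ 2 %| R.
  case/codomP=> j ->; pose L := (x j)%:P + kappa j *: ('X - (t j)%:P).
  (* R does not involve x, so substituting L for x does not change it. *)
  have -> : R = u.[L] * (dehom A).[L] + v.[L] * (dehom B).[L].
    by rewrite -!hornerM -hornerD -ER hornerC.
  by apply: dvdp_add; apply: dvdp_mull; apply: tangent_dvd_sqr.
have ut : uniq (codom t) by rewrite map_inj_uniq ?enum_uniq.
have := dvdp_leq R0 (dvdp_prod_XsubC_sqr ut dR).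
rewrite size_prod_XsubC_sqr size_codom card_ord => le_N.
by rewrite -ltnS (leq_trans le_N).
Qed.

End PlaneCurves.

(** * Counting non-transversal intersections *)

Section PlanarCount.
Variable K : closedFieldType.
Implicit Types (A B : {mpoly K[3]}) (w v : 'I_3 -> K).

(** On the surface y A + B = 0, this says that no singular point lies in the
    plane y = 0. *)
Definition no_double_zero A B :=
  forall w, (exists i, w i != 0) -> A.@[w] = 0 -> B.@[w] = 0 ->
    ~ (forall v, ddir w v B = 0).

(** If C divides A and B = C B', then B vanishes to order two where C = B' = 0.
    The inequality m < n makes B' nonconstant, so that such points exist. *)
Lemma resultant_neq0_no_double m n A B :
  A \is m.-homog -> B \is n.-homog -> (m < n)%N ->
  A.@[pt3 0 0 1] != 0 -> B.@[pt3 0 0 1] != 0 -> no_double_zero A B ->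
  resultant (dehom A) (dehom B) != 0.
Proof.
move=> hA hB lt_mn A3 B3 nd; apply/eqP => R0.
have [k [C [A' [B' [/andP[k0 le_km] hC hB' EA EB]]]]] :=
  common_component hA hB A3 B3 R0.
have C3 : C.@[pt3 0 0 1] != 0.
  by apply: contra_neq A3 => C3; rewrite EA mevalM C3 mul0r.
have B'3 : B'.@[pt3 0 0 1] != 0.
  by apply: contra_neq B3 => B'3; rewrite EB mevalM B'3 mulr0.
have nk0 : (0 < n - k)%N by rewrite subn_gt0 (leq_ltn_trans le_km).
have [w [w0 Cw B'w]] := common_zero hC hB' C3 B'3 k0 nk0.
apply: (nd w w0); rewrite ?EA ?EB ?mevalM ?Cw ?mul0r // => v.
by rewrite ddirM Cw B'w mulr0 mul0r addr0.
Qed.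

(** The derivative of A in the direction of (0 : 0 : 1) is nonzero at each point,
    so the tangent to A = 0 has a finite slope kappa; it is also tangent to B = 0
    because dB is a multiple of dA. *)
Lemma planar_count_normalized m n A B N (w : 'I_N -> 'I_3 -> K) :
  A \is m.-homog -> B \is n.-homog -> (0 < m < n)%N ->
  A.@[pt3 0 0 1] != 0 -> B.@[pt3 0 0 1] != 0 -> no_double_zero A B ->
  (forall j, w j o0 != 0) -> injective (fun j => w j o1 / w j o0) ->
  (forall j, A.@[w j] = 0) -> (forall j, B.@[w j] = 0) ->
  (forall j, exists c, forall v, ddir (w j) v B = c * ddir (w j) v A) ->
  (forall j, ddir (w j) (pt3 0 0 1) A != 0) ->
  (2 * N <= m * n)%N.
Proof.
move=> hA hB /andP[m0 lt_mn] A3 B3 nd w0 w_inj Aw Bw dB dA3.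
pose kappa j := - ddir (w j) (pt3 0 1 0) A / ddir (w j) (pt3 0 0 1) A.
have Ew j : (fun i => (w j o0)^-1 * w j i) =1
    pt3 1 (w j o1 / w j o0) (w j o2 / w j o0).
  by apply: ord3P; rewrite /pt3 /= 1?mulrC ?divff.
have dir_tangent j : ddir (w j) (pt3 0 1 (kappa j)) A = 0.
  rewrite (@eq_ddir _ _ _ (w j) _
    (fun i => pt3 0 1 0 i + kappa j * pt3 0 0 1 i)) //; last first.
    by apply: ord3P; rewrite /pt3 /=; ring.
  by rewrite ddir_dirD ddirZ /kappa divfK // subrr.
have scale_dir d F j : F \is d.-homog -> ddir (w j) (pt3 0 1 (kappa j)) F = 0 ->
    ddir (pt3 1 (w j o1 / w j o0) (w j o2 / w j o0)) (pt3 0 1 (kappa j)) F = 0.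
  move=> hF d0; rewrite -(eq_ddir (w := fun i => (w j o0)^-1 * w j i)
    (v := fun i => (w j o0)^-1 * (w j o0 * pt3 0 1 (kappa j) i))) //.
    by rewrite (ddir_homogZ _ _ _ hF) ddirZ d0 !mulr0.
  by move=> i; rewrite mulrA mulVf ?mul1r.
apply: (@tangency_bound _ m n A B N (fun j => w j o1 / w j o0)
  (fun j => w j o2 / w j o0) kappa) => //; first exact: leq_trans lt_mn.
- exact: resultant_neq0_no_double hA hB lt_mn A3 B3 nd.
- by move=> j; rewrite -(meval_eq _ (Ew j)) (meval_homogZ _ _ hA) Aw mulr0.
- by move=> j; rewrite -(meval_eq _ (Ew j)) (meval_homogZ _ _ hB) Bw mulr0.
- by move=> j; apply: scale_dir hA _.
- move=> j; apply: scale_dir hB _; have [c ->] := dB j.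
  by rewrite dir_tangent mulr0.
Qed.

Definition linmap (M : 'I_3 -> 'I_3 -> K) v : 'I_3 -> K :=
  fun i => \sum_j M i j * v j.

Definition linsubst (M : 'I_3 -> 'I_3 -> K) A : {mpoly K[3]} :=
  A \mPo [tuple \sum_j M i j *: 'X_j | i < 3].

Lemma meval_linsubst M A v : (linsubst M A).@[v] = A.@[linmap M v].
Proof.
rewrite comp_mpoly_meval; apply: meval_eq => i; rewrite tnth_mktuple raddf_sum /=.
by apply: eq_bigr => j _; rewrite mevalZ mevalXU.
Qed.

Lemma ddir_linsubst M A w v :
  ddir w v (linsubst M A) = ddir (linmap M w) (linmap M v) A.
Proof.
rewrite -!along_coef1; suff -> : along w v (linsubst M A) =
  along (linmap M w) (linmap M v) A by [].
apply: poly_ext => s; rewrite !horner_along meval_linsubst; apply: meval_eq => i.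
rewrite /linmap mulr_sumr -big_split; apply: eq_bigr => j _.
by rewrite mulrDr mulrCA.
Qed.

Lemma linsubst_homog M A m : A \is m.-homog -> linsubst M A \is m.-homog.
Proof.
move=> hA; have hL i : \sum_j M i j *: 'X_j \is [in K[3], 1.-homog].
  by apply: rpred_sum => j _; apply: dhomogZ; rewrite dhomogX; apply/eqP/mdeg1.
rewrite /linsubst comp_mpolyE big_seq; apply: rpred_sum => x xA.
apply: dhomogZ; rewrite -(dhomog_mdeg hA xA) mdeg3 big_ord3 !tnth_mktuple.
have hX i k : (\sum_j M i j *: 'X_j) ^+ k \is [in K[3], k.-homog].
  by rewrite -[k in k.-homog]mul1n; apply: dhomogMn.
by do 2!apply: dhomogM => //.
Qed.

Definition linform (l : 'I_3 -> K) : {poly {poly K}} :=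
  ((l o0)%:P + l o1 *: 'X)%:P + (l o2)%:P *: 'X.

Lemma horner_linform l (t x : K) :
  (linform l).[x%:P].[t] = l o0 + l o1 * t + l o2 * x.
Proof. rewrite /linform !hornerE. by []. Qed.

Lemma linform_neq0 l : (exists i, l i != 0) -> linform l != 0.
Proof.
case=> i; apply: contra_neq => l0; move: i.
have E2 : l o2 = 0.
  have := congr1 (fun f : {poly {poly K}} => f`_1`_0) l0.
  by rewrite /linform coefD coefC coefZ coefX /= add0r mulr1 coefC !coef0.
have E01 : (l o0)%:P + l o1 *: 'X = 0 :> {poly K}.
  have := congr1 (fun f : {poly {poly K}} => f`_0) l0.
  by rewrite /linform coefD coefC coefZ coefX mulr_natr mulr0n addr0 coef0.
apply: ord3P => //.
  have := congr1 (fun f : {poly K} => f`_0) E01.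
  by rewrite coefD coefC coefZ coefX mulr_natr mulr0n addr0 coef0.
have := congr1 (fun f : {poly K} => f`_1) E01.
by rewrite coefD coefC coefZ coefX mulr_natr mulr1n add0r coef0.
Qed.

Definition cross w v : 'I_3 -> K :=
  pt3 (w o1 * v o2 - w o2 * v o1) (w o2 * v o0 - w o0 * v o2)
      (w o0 * v o1 - w o1 * v o0).

Lemma cross_eq0 w v :
  (exists i, v i != 0) -> (forall i, cross w v i = 0) ->
  exists c, w =1 (fun i => c * v i).
Proof.
case=> i vi c0; exists (w i / v i).
have /eqP := c0 o0; have /eqP := c0 o1; have /eqP := c0 o2.
rewrite /cross /pt3 /= !subr_eq0 => /eqP e2 /eqP e1 /eqP e0.
have wv k l : w k * v l = w l * v k.
  by move: k l; apply: ord3P; apply: ord3P; rewrite // 1?mulrC 1?[RHS]mulrC.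
by move=> k; rewrite mulrAC (wv i k) mulfK.
Qed.

End PlanarCount.

(** This reduces to [planar_count_normalized] by a choice of coordinates.  The new third basis vector O = (1, t0, x0)
    must lie off both curves, off the tangents to A = 0 at the points w j, and
    off the lines joining two of these points; projecting from O then keeps them
    distinct.  Finally kappa makes the line at infinity avoid all of them. *)
Lemma planar_count (K : closedFieldType) m (A B : {mpoly K[3]}) N
    (y : 'I_N -> K) (w : 'I_N -> 'I_3 -> K) :
  A \is m.-homog -> B \is m.+1.-homog -> (0 < m)%N -> A != 0 ->
  no_double_zero A B ->
  (forall j, exists i, w j i != 0) ->
  (forall j, A.@[w j] = 0) -> (forall j, B.@[w j] = 0) ->
  (forall j v, y j * ddir (w j) v A + ddir (w j) v B = 0) ->
  (forall i j c, y i = c * y j -> w i =1 (fun k => c * w j k) -> i = j) ->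
  (2 * N <= m * m.+1)%N.
Proof.
move=> hA hB m0 A0 nd w0 Aw Bw dAB yw_inj.
pose g j i := (A^`M(i)).@[w j].
have dBE j v : ddir (w j) v B = - y j * ddir (w j) v A.
  by apply/eqP; rewrite mulNr -addr_eq0 addrC dAB.
have g0 j : exists i, g j i != 0.
  apply/not_existsP => g0; apply: (nd _ (w0 j) (Aw j) (Bw j)) => v.
  rewrite dBE; have -> : ddir (w j) v A = 0; last by rewrite mulr0.
  by apply: (ddir_eq0P A (w j)).2 => i; have /negP := g0 i;
     rewrite negbK => /eqP.
(* The points w j are distinct: y j is determined by w j, as dA is nonzero there. *)
have cross_neq0 i j : i != j -> exists k, cross (w i) (w j) k != 0.
  move=> ne_ij; apply/not_existsP => cr0.
  have [|c Ew] := @cross_eq0 _ (w i) (w j) (w0 j).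
    by move=> k; apply/eqP; have /negP := cr0 k; rewrite negbK.
  move/eqP: ne_ij; apply; apply: (yw_inj i j c) => //.
  have c0 : c != 0.
    by have [k] := w0 i; apply: contra_neq => c0; rewrite Ew c0 mul0r.
  have [k gk] := g0 j; pose v (l : 'I_3) : K := (l == k)%:R.
  have := dAB i (fun l => c * v l).
  rewrite !(eq_ddir _ Ew (frefl _)) (ddir_homogZ _ _ _ hA) (ddir_homogZ _ _ _ hB).
  rewrite dBE ddir_delta => /eqP.
  have -> : y i * (c ^+ m * g j k) + c ^+ m.+1 * (- y j * g j k) =
      c ^+ m * g j k * (y i - c * y j) by rewrite exprS; ring.
  rewrite mulf_eq0 mulf_eq0 expf_eq0 (negPf c0) andbF (negPf gk) subr_eq0.
  by move=> /eqP.
have B0 : B != 0.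
  apply/eqP => B0.
  have [w1 [w1n0 Aw1]] : exists w1 : 'I_3 -> K, (exists i, w1 i != 0) /\ A.@[w1] = 0.
    have [A3|A3] := eqVneq (A.@[pt3 0 0 1]) 0.
      by exists (pt3 0 0 1); split=> //; exists o2; apply: oner_neq0.
    by have [w1 [? ? _]] := common_zero hA hA A3 A3 m0 m0; exists w1.
  apply: (nd _ w1n0 Aw1); rewrite B0 ?meval0 // => v.
  by rewrite -mpolyC0 ddirC.
(* The factor 'X ensures x0 != 0, so that the first two basis vectors and O are
   independent. *)
pose f := dehom A * dehom B * 'X * \prod_j linform (g j) *
  \prod_(ij : 'I_N * 'I_N | ij.1 != ij.2) linform (cross (w ij.1) (w ij.2)).
have f0 : f != 0.
  rewrite !mulf_neq0 ?polyX_eq0 ?(dehom_neq0 hA) ?(dehom_neq0 hB) //.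
    by apply/prodf_neq0 => j _; apply: linform_neq0.
  by apply/prodf_neq0 => ij ne_ij; apply/linform_neq0/cross_neq0.
have [t0 [x0]] := bivariate_nonzero f0.
rewrite /f !hornerM !horner_prod hornerX hornerC.
rewrite !mulf_eq0 !negb_or -!andbA !horner_dehom hornerC.
case/and5P=> AO BO x00 /prodf_neq0 gO /prodf_neq0 crossO.
set O := pt3 1 t0 x0 in AO BO.
pose alpha j := w j o0 - w j o2 / x0.
pose beta j := w j o1 - t0 * (w j o2 / x0).
(* alpha j and beta j are the coordinates of w j modulo O; they are not both 0
   as O is not on the curve A = 0, which contains w j. *)
have ab0 j : (alpha j)%:P - beta j *: 'X != 0.
  apply/eqP => ab0.
  have a0 : alpha j = 0.
    have := congr1 (fun p : {poly K} => p.[0]) ab0.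
    by rewrite hornerD hornerN hornerZ hornerC hornerX mulr0 subr0 horner0.
  have b0 : beta j = 0.
    have := congr1 (fun p : {poly K} => p.[1]) ab0.
    rewrite hornerD hornerN hornerZ hornerC hornerX mulr1 a0 sub0r horner0.
    by move/eqP; rewrite oppr_eq0 => /eqP.
  have Ew : w j =1 (fun i => w j o2 / x0 * O i).
    move/eqP: a0; move/eqP: b0; rewrite !subr_eq0 => /eqP b0 /eqP a0.
    apply: ord3P; rewrite /O /pt3 /=; first by rewrite mulr1.
      by rewrite mulrC.
    by rewrite divfK.
  have := Aw j; rewrite (meval_eq _ Ew) (meval_homogZ _ _ hA) => /eqP.
  rewrite mulf_eq0 (negPf AO) orbF expf_eq0 m0 => /eqP c0.
  by have [i] := w0 j; rewrite Ew c0 mul0r eqxx.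
have /closed_nonrootP[kappa] : \prod_j ((alpha j)%:P - beta j *: 'X) != 0.
  by apply/prodf_neq0 => j _; apply: ab0.
rewrite /root horner_prod => /prodf_neq0 kap.
pose M := pt3 (pt3 1 kappa 1) (pt3 0 1 t0) (pt3 0 0 x0).
pose Minv (u : 'I_3 -> K) :=
  pt3 (u o0 - u o2 / x0 - kappa * (u o1 - t0 * (u o2 / x0)))
  (u o1 - t0 * (u o2 / x0)) (u o2 / x0).
have MK u : linmap M (Minv u) =1 u.
  by apply: ord3P; rewrite /linmap big_ord3 /M /Minv /pt3 /=; field.
have MinvK u : Minv (linmap M u) =1 u.
  by apply: ord3P; rewrite /Minv /linmap !big_ord3 /M /pt3 /=; field.
have ME3 : linmap M (pt3 0 0 1) =1 O.
  by apply: ord3P; rewrite /linmap big_ord3 /M /O /pt3 /=; ring.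
apply: (@planar_count_normalized _ m m.+1 (linsubst M A) (linsubst M B) N
  (fun j => Minv (w j))).
- exact: linsubst_homog.
- exact: linsubst_homog.
- by rewrite m0 ltnS leqnn.
- by rewrite meval_linsubst (meval_eq _ ME3).
- by rewrite meval_linsubst (meval_eq _ ME3).
- move=> u [i ui]; rewrite !meval_linsubst => Au Bu dBu.
  apply: (nd (linmap M u)) => // [|v].
    apply/not_existsP => Mu; move/negP: ui; apply; rewrite -MinvK.
    have {}Mu k : linmap M u k = 0.
      by apply/eqP; have /negP := Mu k; rewrite negbK.
    apply/eqP; move: i; apply: ord3P; rewrite /Minv /pt3 /= !Mu; ring.
  by rewrite -(dBu (Minv v)) ddir_linsubst; apply: eq_ddir => // k; rewrite MK.
- by move=> j; have := kap j isT; rewrite hornerD hornerN hornerZ hornerC hornerX mulrC.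
- move=> i j /= Eij; apply/eqP; apply: contraT => ne_ij.
  have := crossO (i, j) ne_ij; rewrite horner_linform /= => /negP[]; apply/eqP.
  (* Up to the factor x0, the determinant of w i, w j and O is the difference
     of the cross products in Eij. *)
  have Di := kap i isT; have Dj := kap j isT.
  rewrite hornerD hornerN hornerZ hornerC hornerX mulrC in Di.
  rewrite hornerD hornerN hornerZ hornerC hornerX mulrC in Dj.
  move/eqP: Eij; rewrite eqr_div // -subr_eq0 => /eqP Eij.
  rewrite -[RHS](mulr0 (- x0)) -Eij /cross /Minv /pt3 /=; field.
  by [].
- by move=> j; rewrite meval_linsubst (meval_eq _ (MK _)).
- by move=> j; rewrite meval_linsubst (meval_eq _ (MK _)).
- move=> j; exists (- y j) => v; rewrite !ddir_linsubst.
  by rewrite !(eq_ddir _ (MK _) (frefl _)) dBE.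
- move=> j; rewrite ddir_linsubst (eq_ddir _ (MK _) ME3).
  have := gO j isT; rewrite horner_linform; apply: contra_neq => <-.
  rewrite /ddir big_ord3 /O /pt3 /g /=; ring.
Qed.

(** * Points of projective space and singular points *)

Section ProjectivePoints.
Variables (K : fieldType) (n : nat).
Implicit Types (p q : proj_space K n) (v : 'I_n.+1 -> K).

Lemma vpick_point_neq0 p : vpick (val p) != 0.
Proof.
rewrite vpick0 -dimv_eq0; have /eqP -> := valP p; exact: oner_neq0.
Qed.

Lemma coords_neq0 p : exists i, coords p i != 0.
Proof. by apply/rV0Pn; apply: vpick_point_neq0. Qed.

Lemma point_line p : val p = <[vpick (val p)]>%VS.
Proof.
apply/eqP; rewrite eq_sym eqEdim -memvE memv_pick dim_vline vpick_point_neq0.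
by have /eqP -> := valP p.
Qed.

Lemma coords_inj p q c : coords p =1 (fun i => c * coords q i) -> p = q.
Proof.
move=> E; have Epq : vpick (val p) = c *: vpick (val q).
  by apply/rowP => i; rewrite mxE; apply: E.
have c0 : c != 0.
  by apply: contraNneq (vpick_point_neq0 p) => c0; rewrite Epq c0 scale0r.
apply: val_inj; apply/eqP; rewrite [val p]point_line eqEdim.
rewrite -memvE {1}Epq memvZ ?memv_pick //= dim_vline vpick_point_neq0.
by have /eqP -> := valP q.
Qed.

Lemma point_of_vector v : (exists i, v i != 0) ->
  exists p c, c != 0 /\ coords p =1 (fun i => c * v i).
Proof.
case=> i vi; pose r : 'rV[K]_n.+1 := \row_j v j.
have r0 : r != 0 by apply/rV0Pn; exists i; rewrite mxE.
have dr : \dim <[r]> == 1%N by rewrite dim_vline r0.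
pose p : proj_space K n := exist _ <[r]>%VS dr.
have /vlineP[c Ec] : vpick (val p) \in <[r]>%VS by apply: memv_pick.
exists p, c; split; last by move=> j; rewrite /coords Ec !mxE.
by apply: contraNneq (vpick_point_neq0 p) => c0; rewrite Ec c0 scale0r.
Qed.

End ProjectivePoints.

(** The hyperplanes with coefficients (1, t, t^2, ...) suffice: each point lies on
    finitely many of them. *)
Lemma avoiding_hyperplane (K : closedFieldType) n (s : seq (proj_space K n)) :
  exists h : 'I_n.+1 -> K,
    forall p, p \in s -> \sum_i h i * coords p i != 0.
Proof.
pose f (p : proj_space K n) : {poly K} := \poly_(i < n.+1) coords p (inord i).
have : \prod_(p <- s) f p != 0.
  rewrite prodf_seq_neq0; apply/allP => p _ /=; have [i] := coords_neq0 p.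
  apply: contraNneq => /(congr1 (fun q : {poly K} => q`_i)).
  by rewrite coef0 coef_poly ltn_ord inord_val => ->.
move=> /closed_nonrootP[t]; rewrite /root horner_prod prodf_seq_neq0 => /allP ft.
exists (fun i => t ^+ i) => p /ft /=; congr (_ != 0); rewrite horner_poly.
by apply: eq_bigr => i _; rewrite inord_val mulrC.
Qed.

Definition singular_at (K : fieldType) n (F : {mpoly K[n]}) (v : 'I_n -> K) :=
  F.@[v] = 0 /\ forall u, ddir v u F = 0.

Lemma SingE (K : fieldType) n (F : {mpoly K[n.+1]}) (p : proj_space K n) :
  Sing F p <-> singular_at F (coords p).
Proof. by split=> -[Fp dF]; split=> //; apply/ddir_eq0P. Qed.

Lemma singular_atZ (K : closedFieldType) n d (F : {mpoly K[n]}) v c :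
  F \is d.-homog -> c != 0 -> singular_at F v -> singular_at F (fun i => c * v i).
Proof.
move=> hF c0 [Fv dF]; split=> [|u]; first by rewrite (meval_homogZ _ _ hF) Fv mulr0.
rewrite (@eq_ddir _ _ _ (fun i => c * v i) _ (fun i => c * (c^-1 * u i))) //.
  by rewrite (ddir_homogZ _ _ _ hF) dF mulr0.
by move=> i; rewrite mulVKf.
Qed.

(** The partial derivatives of a linear form are its coefficients. *)
Lemma linear_form_smooth (K : fieldType) n (F : {mpoly K[n]}) v :
  F \is 1.-homog -> F != 0 -> ~ singular_at F v.
Proof.
move=> hF F0 [_ /ddir_eq0P dF]; move/eqP: F0; apply; apply/mpolyP => m.
rewrite mcoeff0; have [/eqP/mdeg1P[i /eqP ->]|ne_m] := eqVneq (mdeg m) 1%N; last first.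
  exact: dhomog_nemf_coeff hF ne_m.
have EF : F^`M(i) = (F@_U_(i))%:MP.
  apply/mpolyP => m'; rewrite mcoeff_deriv mcoeffC.
  have [->|m'0] := eqVneq m' 0%MM; first by rewrite add0m mnm0E mulr1.
  rewrite mulr0 (dhomog_nemf_coeff hF) ?mul0rn //.
  by apply: contra m'0; rewrite /= mdegD mdeg1 addn1 eqSS mdeg_eq0.
by have := dF i; rewrite EF mevalC.
Qed.

(** * Equation of a surface with a point of multiplicity d - 1 *)

Lemma msizeM_bound (R : idomainType) n (p q : {mpoly R[n]}) k l :
  (msize p <= k.+1)%N -> (msize q <= l.+1)%N -> (msize (p * q)%R <= (k + l).+1)%N.
Proof.
have [->|p0] := eqVneq p 0; first by rewrite mul0r msize0.
have [->|q0] := eqVneq q 0; first by rewrite mulr0 msize0.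
rewrite msizeM //; move: (msize p) (msize q) => a b; lia.
Qed.

Lemma msize_comp_affine (R : idomainType) n k d (F : {mpoly R[n]})
    (lq : n.-tuple {mpoly R[k]}) :
  F \is d.-homog -> (forall i, msize (tnth lq i) <= 2)%N ->
  (msize (F \mPo lq) <= d.+1)%N.
Proof.
move=> hF slq; rewrite comp_mpolyE big_seq.
apply: leq_trans (msize_sum _ _ _) _; apply/bigmax_leqP_seq => m _ mF.
apply: leq_trans (msizeZ_le _ _) _; rewrite -(dhomog_mdeg hF mF) mdegE.
pose P (p : {mpoly R[k]}) e := (msize p <= e.+1)%N.
rewrite -/(P _ _); elim/big_ind2: _ => [|p a q b|i _].
- by rewrite /P msize1.
- exact: msizeM_bound.
elim: (m i) => [|e IH]; first by rewrite /P expr0 msize1.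
by rewrite exprS -add1n; apply: msizeM_bound.
Qed.

(** The vector y c' + w, where c' is the multiple of c with coordinate 1 at i and
    w is placed on the other coordinates. *)
Definition cone_point (K : fieldType) n (c : 'I_n.+1 -> K) (i : 'I_n.+1)
    (y : K) (w : 'I_n -> K) : 'I_n.+1 -> K :=
  fun j => y * (c j / c i) + (if unlift i j is Some k then w k else 0).

Lemma meval_local_eq (K : fieldType) n (F : {mpoly K[n.+1]}) c i w :
  c i != 0 -> (local_eq F c i).@[w] = F.@[cone_point c i 1 w].
Proof.
move=> ci; rewrite comp_mpoly_meval; apply: meval_eq => j.
rewrite tnth_mktuple /cone_point mul1r.
case: unliftP => [k ->|->]; last by rewrite meval1 divff // addr0.
by rewrite mevalD mevalXU mevalC addrC.
Qed.

(** The local equation f at p has degree at most d + 2, and its multiplicity is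
    d + 1; it is thus the sum of a form A of degree d + 1 and of a form B of
    degree d + 2.  Then F(y, w) = y^(d + 2) f(w / y) = y A(w) + B(w) for y != 0,
    and for y = 0 too since both sides are polynomials in y. *)
Lemma multiplicity_cone_form (K : closedFieldType) n d (F : {mpoly K[n.+1]})
    (p : proj_space K n) :
  F \is d.+2.-homog -> multiplicity F p = d.+1 ->
  exists i A B, [/\ coords p i != 0, A \is d.+1.-homog, A != 0,
    B \is d.+2.-homog &
    forall y w, F.@[cone_point (coords p) i y w] = y * A.@[w] + B.@[w]].
Proof.
move=> hF; rewrite /multiplicity; case: pickP => [i ci|//] multF.
set f := local_eq F _ i in multF; exists i.
have sf : (msize f <= d.+3)%N.
  apply: msize_comp_affine hF _ => j; rewrite tnth_mktuple.
  case: unliftP => [k _|_]; last by rewrite msize1.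
  apply: leq_trans (msizeD_le _ _) _; rewrite msizeX mdeg1 geq_max /=.
  by rewrite msizeC; case: (_ != 0).
have f0 : f != 0.
  by apply: contra_eq_neq multF => ->; rewrite /order_at_origin mlast0 mdeg0.
have degf m : m \in msupp f -> mdeg m = d.+1 \/ mdeg m = d.+2.
  move=> mf; have lt_m : (mdeg m < d.+3)%N := leq_trans (msize_mdeg_lt mf) sf.
  have le_m : (d.+1 <= mdeg m)%N by rewrite -multF; apply/lemc_mdeg/mlast_lemc.
  by clear -lt_m le_m; lia.
pose A := pihomog mdeg d.+1 f; pose B := pihomog mdeg d.+2 f.
have Ef : f = A + B.
  rewrite {1}[f]mpolyE (bigID (fun m => mdeg m == d.+1)) /= /A /B !pihomogE.
  congr (_ + _); rewrite big_seq_cond [RHS]big_seq_cond; apply: eq_bigl => m.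
  by case: (boolP (m \in msupp f)) => // /degf[] Em; rewrite /= ?Em; lia.
have hA : A \is d.+1.-homog by apply: pihomogP.
have hB : B \is d.+2.-homog by apply: pihomogP.
have A0 : A != 0.
  apply/eqP => A0; have := mlast_supp f0; rewrite {2}Ef A0 add0r.
  by move/(dhomog_mdeg hB) => /eqP; rewrite [mdeg _]multF; lia.
exists A, B; split=> // y w.
have along_y z : (along (cone_point (coords p) i 0 w)
    (fun j => coords p j / coords p i) F).[z] = F.@[cone_point (coords p) i z w].
  rewrite horner_along; apply: meval_eq => j; rewrite /cone_point; ring.
have E : along (cone_point (coords p) i 0 w) (fun j => coords p j / coords p i) F
    = A.@[w] *: 'X + (B.@[w])%:P.
  apply: poly_ext_neq0 => z z0; rewrite along_y hornerD hornerZ hornerX hornerC.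
  rewrite (@meval_eq _ _ _ (fun j => z * cone_point (coords p) i 1
    (fun k => z^-1 * w k) j)); last first.
    move=> j; rewrite /cone_point; case: (unlift i j) => [k|]; last by ring.
    by rewrite mulrDr mulVKf // mul1r.
  rewrite (meval_homogZ _ _ hF) -meval_local_eq // -/f Ef mevalD.
  rewrite (meval_homogZ _ _ hA) (meval_homogZ _ _ hB) !exprVn !exprS.
  have := expf_neq0 d z0; move: (z ^+ d) => zd zd0.
  by field; rewrite z0 zd0.
by rewrite -along_y E hornerD hornerZ hornerX hornerC mulrC.
Qed.

(** * The count of singular points *)

Section ConePoint.
Variables (K : fieldType) (n : nat) (c : 'I_n.+1 -> K) (i : 'I_n.+1).
Hypothesis ci : c i != 0.

Lemma cone_pointD y y' w w' s :
  cone_point c i (y + s * y') (fun k => w k + s * w' k) =1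
    (fun j => cone_point c i y w j + s * cone_point c i y' w' j).
Proof. by move=> j; rewrite /cone_point; case: (unlift i j) => [k|]; ring. Qed.

Lemma cone_pointZ y w s :
  cone_point c i (s * y) (fun k => s * w k) =1 (fun j => s * cone_point c i y w j).
Proof. by move=> j; rewrite /cone_point; case: (unlift i j) => [k|]; ring. Qed.

Definition cone_base (u : 'I_n.+1 -> K) : 'I_n -> K :=
  fun k => u (lift i k) - u i * (c (lift i k) / c i).

Lemma cone_pointK u : cone_point c i (u i) (cone_base u) =1 u.
Proof.
move=> j; rewrite /cone_point /cone_base; case: unliftP => [k ->|->].
  by rewrite addrC subrK.
by rewrite divff // mulr1 addr0.
Qed.

Lemma cone_point_neq0 y w : (exists k, w k != 0) ->
  exists j, cone_point c i y w j != 0.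
Proof.
case=> k wk; have [y0|y0] := eqVneq y 0.
  by exists (lift i k); rewrite /cone_point liftK y0 mul0r add0r.
by exists i; rewrite /cone_point unlift_none divff // mulr1 addr0.
Qed.

Lemma sum_cone_point (h : 'I_n.+1 -> K) y w :
  \sum_j h j * cone_point c i y w j =
    y * (\sum_j h j * (c j / c i)) + \sum_k h (lift i k) * w k.
Proof.
rewrite mulr_sumr (bigD1_ord i) //= [in RHS](bigD1_ord i) //=.
rewrite /cone_point unlift_none addr0 -addrA mulrCA; congr (_ + _).
rewrite -big_split; apply: eq_bigr => k _ /=; rewrite liftK; ring.
Qed.

End ConePoint.

(** The hyperplane h avoids p and the singular points.  In the coordinates (y, w)
    given by Phi it is the plane y = 0, and the equation of the surface becomes
    y A + B2. *)
Lemma Sing_count (K : closedFieldType) d (F : {mpoly K[4]}) (p : proj_space K 3)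
    (s : seq (proj_space K 3)) :
  F \is d.+2.-homog -> multiplicity F p = d.+1 -> uniq s ->
  (forall q, q \in s <-> Sing F q) ->
  (2 * (size s).-1 <= d.+1 * d.+2)%N.
Proof.
move=> hF multF us sP.
have [i [A [B [ci hA A0 hB FE]]]] := multiplicity_cone_form hF multF.
set c := coords p in ci FE.
have [h h_avoid] := avoiding_hyperplane (p :: s).
pose hc := \sum_j h j * (c j / c i).
have hc0 : hc != 0.
  have Ehc : \sum_j h j * coords p j = hc * c i.
    by rewrite mulr_suml; apply: eq_bigr => j _; rewrite -mulrA divfK.
  have := h_avoid p (mem_head _ _); rewrite Ehc.
  by apply: contra_neq => ->; rewrite mul0r.
pose L : {mpoly K[3]} := \sum_k (h (lift i k) / hc) *: 'X_k.
have LE w : L.@[w] = (\sum_k h (lift i k) * w k) / hc.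
  rewrite raddf_sum mulr_suml; apply: eq_bigr => k _ /=.
  by rewrite mevalZ mevalXU mulrAC.
have LD w w' z : L.@[fun k => w k + z * w' k] = L.@[w] + z * L.@[w'].
  rewrite !LE mulrA -mulrDl mulr_sumr -big_split; congr (_ / _).
  by apply: eq_bigr => k _ /=; ring.
pose Phi y w := cone_point c i (y - L.@[w]) w.
pose B2 := B - L * A.
have hB2 : B2 \is d.+2.-homog.
  have hL : L \is 1.-homog.
    apply: rpred_sum => k _.
    by apply: dhomogZ; rewrite dhomogX; apply/eqP/mdeg1.
  by rewrite rpredB //; apply: (dhomogM hL hA).
have FPhi y w : F.@[Phi y w] = y * A.@[w] + B2.@[w].
  by rewrite FE mevalB mevalM; ring.
have dFPhi y w y' w' : ddir (Phi y w) (Phi y' w') F =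
    y * ddir w w' A + y' * A.@[w] + ddir w w' B2.
  have E : along (Phi y w) (Phi y' w') F =
      (y%:P + y' *: 'X) * along w w' A + along w w' B2.
    apply: poly_ext => z; rewrite hornerD hornerM hornerD hornerZ hornerC hornerX.
    rewrite !horner_along [y' * z]mulrC -FPhi; apply: meval_eq => j.
    rewrite -cone_pointD; congr (cone_point _ _ _ _ _); rewrite LD; ring.
  rewrite -along_coef1 E coefD coefM big_ord_recl big_ord1 /= !along_coef0.
  rewrite !along_coef1 !coefD !coefC !coefZ !coefX /=.
  by rewrite mulr0 mulr1 addr0 add0r.
have PhiK u : exists y, u =1 Phi y (cone_base c i u).
  exists (u i + L.@[cone_base c i u]) => j.
  by rewrite /Phi addrK cone_pointK.
have sing_Phi y w : singular_at F (Phi y w) <->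
    [/\ A.@[w] = 0, B2.@[w] = 0 & forall v, y * ddir w v A + ddir w v B2 = 0].
  split=> [[F0 dF]|[Aw Bw dAB]].
    have Aw : A.@[w] = 0.
      have d0 G : ddir w (fun=> 0) G = 0.
        by rewrite /ddir big1 // => k _; rewrite mul0r.
      by have := dF (Phi 1 (fun=> 0)); rewrite dFPhi mul1r !d0 mulr0 add0r addr0.
    split=> // [|v]; first by move: F0; rewrite FPhi Aw mulr0 add0r.
    by have := dF (Phi 0 v); rewrite dFPhi Aw mulr0 addr0.
  split=> [|u]; first by rewrite FPhi Aw Bw mulr0 addr0.
  have [y' Eu] := PhiK u; rewrite (eq_ddir _ (frefl _) Eu) dFPhi Aw mulr0 addr0.
  exact: dAB.
(* A double zero would be a singular point in the plane h = 0. *)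
have nd : no_double_zero A B2.
  move=> w w0 Aw Bw dB.
  have sv : singular_at F (Phi 0 w).
    by apply/sing_Phi; split=> // v; rewrite mul0r add0r.
  have [q [e [e0 Eq]]] := point_of_vector (cone_point_neq0 ci (0 - L.@[w]) w0).
  have qs : q \in s.
    apply/sP/SingE; have [Fq dFq] := singular_atZ hF e0 sv.
    split=> [|u]; first by rewrite (meval_eq _ Eq).
    by rewrite (eq_ddir _ Eq (frefl u)).
  have := h_avoid q; rewrite inE qs orbT => /(_ isT) /negP[]; apply/eqP.
  have -> : \sum_j h j * coords q j =
      e * \sum_j h j * cone_point c i (0 - L.@[w]) w j.
    by rewrite mulr_sumr; apply: eq_bigr => j _; rewrite Eq mulrCA.
  rewrite sum_cone_point -/hc sub0r mulNr LE divfK // addNr.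
  exact: mulr0.
pose s' := rem p s.
have us' : uniq s' by apply: rem_uniq.
have sP' q : q \in s' -> q != p /\ Sing F q.
  by rewrite mem_rem_uniq // inE => /andP[ne_qp /sP].
have le_s : ((size s).-1 <= size s')%N.
  have [ps|/rem_id Es] := boolP (p \in s); first by rewrite size_rem.
  by rewrite /s' Es leq_pred.
pose q (j : 'I_(size s')) := tnth (in_tuple s') j.
have qs j : q j \in s' by apply: mem_tnth.
have [y yP] := choice (fun j => PhiK (coords (q j))).
pose w j := cone_base c i (coords (q j)).
have sing_q j : singular_at F (Phi (y j) (w j)).
  have [_ /SingE[F0 dF]] := sP' _ (qs j).
  split=> [|u]; first by rewrite -(meval_eq _ (yP j)).
  by rewrite -(eq_ddir _ (yP j) (frefl u)).
have le_N : (2 * size s' <= d.+1 * d.+2)%N.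
  apply: (@planar_count _ d.+1 A B2 (size s') y w) => // [j|j|j|j|j j' e Ey Ew].
  (* If w j = 0, the point q j is p. *)
  - apply/not_existsP => w0; have [/eqP[]] := sP' _ (qs j).
    apply: (@coords_inj _ _ _ _ (coords (q j) i / c i)) => k.
    rewrite -[LHS](cone_pointK ci) /cone_point.
    have wE l : cone_base c i (coords (q j)) l = 0.
      by apply/eqP; have /negP := w0 l; rewrite negbK.
    rewrite mulrAC -mulrA; case: (unlift i k) => [l|]; rewrite ?wE addr0 //.
  - by have /sing_Phi[] := sing_q j.
  - by have /sing_Phi[] := sing_q j.
  - by have /sing_Phi[] := sing_q j.
  have Eq : q j = q j'.
    apply: (@coords_inj _ _ _ _ e) => k; rewrite yP yP /Phi -cone_pointZ.
    rewrite /cone_point; congr (_ * _ + _); last by case: (unlift i k).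
    rewrite (meval_eq _ Ew) Ey !LE mulrBr mulrA mulr_sumr; congr (_ - _).
    by congr (_ / _); apply: eq_bigr => l _; rewrite mulrCA.
  move: Eq; rewrite /q !(tnth_nth p) /= => /eqP.
  by rewrite nth_uniq // => /eqP/val_inj.
by apply: leq_trans le_N; rewrite leq_mul2l le_s.
Qed.

Local Open Scope fset_scope.

Theorem proposition1 (K : closedFieldType) :
  (forall F : {mpoly K[4]},
     F != 0 -> F \is 4.-homog ->
     finite_set (Sing F) ->
     (exists2 p : proj_space K 3, hypersurface F p & multiplicity F p = 3%N) ->
     (#|` fset_set (Sing F)| <= 7)%N)
  /\
  (forall (d : nat) (F : {mpoly K[4]}),
     (0 < d)%N -> F != 0 -> F \is d.-homog ->
     finite_set (Sing F) ->
     (exists2 p : proj_space K 3,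
        hypersurface F p & multiplicity F p = (d - 1)%N) ->
     (#|` fset_set (Sing F)| <= 1 + (d * (d - 1)) %/ 2)%N).
Proof.
have general (d : nat) (F : {mpoly K[4]}) :
     (0 < d)%N -> F != 0 -> F \is d.-homog ->
     finite_set (Sing F) ->
     (exists2 p : proj_space K 3,
        hypersurface F p & multiplicity F p = (d - 1)%N) ->
     (#|` fset_set (Sing F)| <= 1 + (d * (d - 1)) %/ 2)%N.
  case: d => // -[|d] _ F0 hF finS [p _ multF].
    (* A plane is smooth. *)
    have -> : Sing F = set0.
      by apply/seteqP; split=> // q /SingE/(linear_form_smooth hF F0).
    by rewrite fset_set0 cardfs0.
  rewrite subSS subn0 in multF *.
  have sP q : q \in enum_fset (fset_set (Sing F)) <-> Sing F q.
    by rewrite in_fset_set // in_setE.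
  have := Sing_count hF multF (fset_uniq _) sP.
  rewrite -leq_subLR subn1 leq_divRL // [(_ * 2)%N]mulnC [(d.+2 * _)%N]mulnC.
  by [].
split=> // F F0 hF finS [p Fp multF].
by apply: (general 4) => //; exists p.
Qed.
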